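(* Let $\Omega\subset\mathbb{R}^n$ be compact. Suppose there is $\rho_1>0$ such that $\|f_p(x)-f_p(y)\|\le\rho_1\|x-y\|$ for all $x,y\in\Omega$ and all $p\in\mathcal{M}$. For a precision $\varepsilon>0$, let $\overline{Y}^{\varepsilon}$ denote the output of the outer-approximation algorithm (described in the context) run on $\Omega$ with precision $\varepsilon$. Then the algorithm terminates in a finite number of steps. Furthermore, $\overline{Y}^{\varepsilon}$ is a union of intervals (boxes) satisfying: (i) $I(\overline{Y}^{\varepsilon})\subset\overline{Y}^{\varepsilon}\subset I(\overline{Y}^{\varepsilon}\oplus\mathcal{B}_{\rho_1\varepsilon})$; (ii) if $0<\varepsilon_1<\varepsilon_2$, then $\mathcal{I}^{\infty}(\Omega)\subset\overline{Y}^{\varepsilon_1}\subset\overline{Y}^{\varepsilon_2}$; (iii) $\mathcal{I}^{\infty}(\Omega)=\lim_{\varepsilon\to0}\overline{Y}^{\varepsilon}$.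
   Context: Switched system: $x_{k+1}=f_{p_k}(x_k)$, $k\in\mathbb{Z}_{\ge0}$, with state $x_k\in\mathbb{R}^n$, mode $p_k\in\mathcal{M}$, $\mathcal{M}$ a finite nonempty set, and each $f_p:\mathbb{R}^n\to\mathbb{R}^n$ continuous. A switching signal is an infinite sequence $\{p_k\}_{k\ge0}$ in $\mathcal{M}$. A set $A\subset\mathbb{R}^n$ is controlled invariant if for every $x_0\in A$ there is a switching signal whose resulting solution satisfies $x_k\in A$ for all $k\ge0$. $\mathcal{I}^{\infty}(\Omega)$ denotes the maximal controlled invariant set inside $\Omega$: the controlled invariant subset of $\Omega$ that contains all controlled invariant subsets of $\Omega$. $\mathrm{Pre}(A):=\{x\in\mathbb{R}^n:\exists p\in\mathcal{M},\ f_p(x)\in A\}$ and $I(A):=\mathrm{Pre}(A)\cap A$. $\|\cdot\|$ is the infinity norm; $\mathcal{B}_s:=\{y\in\mathbb{R}^n:\|y\|\le s\}$; $A\oplus B:=\{a+b: a\in A,b\in B\}$. A box (interval) is $[x]=[\underline{x}_1,\overline{x}_1]\times\cdots\times[\underline{x}_n,\overline{x}_n]$, with width $w([x])=\max_i(\overline{x}_i-\underline{x}_i)$; $\mathbb{IR}^n$ is the set of boxes. For each $p$, $[f_p]:\mathbb{IR}^n\to\mathbb{IR}^n$ is a fixed convergent inclusion function of $f_p$: $f_p([x])\subset[f_p]([x])$ for all $[x]\in\mathbb{IR}^n$, and $\lim_{w([x])\to0}w([f_p]([x]))=0$. It is chosen so that $w([f_p]([x]))\le\rho_1 w([x])$ for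 all boxes $[x]\subset\Omega$. Procedure CPre$(Y,L,\varepsilon)$: the input is a target set $Y$, a finite list $L$ of boxes and $\varepsilon>0$. Start with $\underline{X},\Delta X,X_c$ empty. While $L$ is nonempty, remove a box $[x]$ from $L$ and do the following. - If $[f_p]([x])\cap Y=\varnothing$ for all $p\in\mathcal{M}$, put $[x]$ in $X_c$. - Otherwise, if $[f_p]([x])\subset Y$ for some $p\in\mathcal{M}$, put $[x]$ in $\underline{X}$. - Otherwise, if $w([x])<\varepsilon$, put $[x]$ in $\Delta X$. - Otherwise, bisect $[x]$ at the midpoint of a coordinate in which its width is attained, and add the two halves to $L$. The output is $(\underline{X},\Delta X,X_c)$. Outer-approximation algorithm: $\Omega$ is assumed to be a finite union of boxes. Initialize $L$ as a finite list of boxes (with pairwise disjoint interiors) whose union is $\Omega$, and $Y:=\Omega$. Repeat: compute $(\underline{X},\Delta X,X_c)=$ CPre$(Y,L,\varepsilon)$, then set $L:=\underline{X}\cup\Delta X$ and $Y:=\bigcup_{[x]\in L}[x]$. Stop as soon as $X_c=\varnothing$. Output $Y$. The limit of a decreasing family of sets is understood as the set limit, i.e. its intersection ($\lim_{\varepsilon\to0}\overline{Y}^{\varepsilon}=\bigcap_{\varepsilon>0}\overline{Y}^{\varepsilon}$).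
   Formalization: In (ii), the inclusion of the output for ε₁ in the output for ε₂ is proved only when each [f_p] is inclusion isotone on boxes inside Ω ([x]⊂[y]⊂Ω implies [f_p]([x])⊂[f_p]([y])); without this it can fail. All other claims are proved as stated. *)

(* Defs.v *)
From HB Require Import structures.
From mathcomp Require Import all_boot all_order all_algebra.
From mathcomp Require Import all_classical all_reals all_analysis.
From Stdlib Require Export Relation_Operators.

Set Implicit Arguments.
Unset Strict Implicit.
Unset Printing Implicit Defensive.

Import Order.TTheory GRing.Theory Num.Theory.
Import numFieldNormedType.Exports.

Local Open Scope classical_set_scope.
Local Open Scope ring_scope.

(* R^n is 'rV[R]_n, whose canonical norm `|x| is the infinity norm. *)

Fixpoint solution (R : realType) (n : nat) (M : Type)
    (f : M -> 'rV[R]_n -> 'rV[R]_n) (p : nat -> M) (x0 : 'rV[R]_n) (k : nat) :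
    'rV[R]_n :=
  if k is k'.+1 then f (p k') (solution f p x0 k') else x0.

Definition controlled_invariant (R : realType) (n : nat) (M : Type)
    (f : M -> 'rV[R]_n -> 'rV[R]_n) (A : set 'rV[R]_n) : Prop :=
  forall x0, A x0 -> exists p : nat -> M, forall k, A (solution f p x0 k).

Definition is_max_controlled_invariant (R : realType) (n : nat) (M : Type)
    (f : M -> 'rV[R]_n -> 'rV[R]_n) (Omega J : set 'rV[R]_n) : Prop :=
  [/\ controlled_invariant f J, J `<=` Omega &
      forall A, controlled_invariant f A -> A `<=` Omega -> A `<=` J].

Lemma is_max_controlled_invariant_ex (R : realType) (n : nat) (M : Type)
    (f : M -> 'rV[R]_n -> 'rV[R]_n) (Omega : set 'rV[R]_n) :
  exists J, is_max_controlled_invariant f Omega J.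
Proof.
exists (\bigcup_(A in [set A | controlled_invariant f A /\ A `<=` Omega]) A).
split.
- move=> x [A [Ainv AO] Ax]; have [p Ap] := Ainv x Ax.
  by exists p => k; exists A => //; exact: Ap.
- by move=> x [A [_ AO] Ax]; exact: AO.
- by move=> A Ainv AO x Ax; exists A.
Qed.

Definition pre (R : realType) (n : nat) (M : Type)
    (f : M -> 'rV[R]_n -> 'rV[R]_n) (A : set 'rV[R]_n) : set 'rV[R]_n :=
  [set x | exists p, A (f p x)].

Definition pre_in (R : realType) (n : nat) (M : Type)
    (f : M -> 'rV[R]_n -> 'rV[R]_n) (A : set 'rV[R]_n) : set 'rV[R]_n :=
  pre f A `&` A.

Definition cball (R : realType) (n : nat) (s : R) : set 'rV[R]_n :=
  [set y | `|y| <= s].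
Arguments cball {R} n s.

Definition minkowski_sum (R : realType) (n : nat) (A B : set 'rV[R]_n) :
    set 'rV[R]_n :=
  [set a + b | a in A & b in B].

(* Boxes are nonempty; degenerate sides are allowed. *)
Record box (R : realType) (n : nat) : Type := Box {
  bounds : 'rV[R]_n * 'rV[R]_n ;
  _ : [forall i, bounds.1 0 i <= bounds.2 0 i] }.

HB.instance Definition _ (R : realType) (n : nat) :=
  [isSub for @bounds R n].
HB.instance Definition _ (R : realType) (n : nat) :=
  [Choice of box R n by <:].

Definition lo (R : realType) (n : nat) (b : box R n) : 'rV[R]_n := (bounds b).1.
Definition hi (R : realType) (n : nat) (b : box R n) : 'rV[R]_n := (bounds b).2.

Definition box_set (R : realType) (n : nat) (b : box R n) : set 'rV[R]_n :=
  [set x | forall i, lo b 0 i <= x 0 i <= hi b 0 i].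

Definition box_union (R : realType) (n : nat) (L : seq (box R n)) :
    set 'rV[R]_n :=
  \bigcup_(b in [set` L]) box_set b.

Definition side (R : realType) (n : nat) (b : box R n) (i : 'I_n) : R :=
  hi b 0 i - lo b 0 i.

Definition width (R : realType) (n : nat) (b : box R n) : R :=
  \big[Num.max/0]_(i < n) side b i.

Definition set_coord (R : realType) (n : nat) (v : 'rV[R]_n) (j : 'I_n) (a : R) :
    'rV[R]_n :=
  \row_i (if i == j then a else v 0 i).

Definition mid (R : realType) (n : nat) (b : box R n) (j : 'I_n) : R :=
  (lo b 0 j + hi b 0 j) / 2.

Lemma lower_half_subproof (R : realType) (n : nat) (b : box R n) (j : 'I_n) :
  let c := (lo b, set_coord (hi b) j (mid b j)) in
  [forall i, c.1 0 i <= c.2 0 i].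
Proof.
apply/forallP => i /=; have /forallP le_b := valP b; rewrite mxE.
case: eqP => [->|_]; last exact: le_b.
exact: (midf_le (le_b j)).1.
Qed.

Lemma upper_half_subproof (R : realType) (n : nat) (b : box R n) (j : 'I_n) :
  let c := (set_coord (lo b) j (mid b j), hi b) in
  [forall i, c.1 0 i <= c.2 0 i].
Proof.
apply/forallP => i /=; have /forallP le_b := valP b; rewrite mxE.
case: eqP => [->|_]; last exact: le_b.
exact: (midf_le (le_b j)).2.
Qed.

Definition lower_half (R : realType) (n : nat) (b : box R n) (j : 'I_n) :
  box R n := Box (lower_half_subproof b j).

Definition upper_half (R : realType) (n : nat) (b : box R n) (j : 'I_n) :
  box R n := Box (upper_half_subproof b j).

Definition pairwise_disjoint_interiors (R : realType) (n : nat)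
    (L : seq (box R n)) : Prop :=
  trivIset [set: 'I_(size L)]
    (fun i => interior (box_set (tnth (in_tuple L) i))).

Definition convergent_inclusion (R : realType) (n : nat)
    (g : 'rV[R]_n -> 'rV[R]_n) (G : box R n -> box R n) : Prop :=
  (forall b, g @` box_set b `<=` box_set (G b)) /\
  (forall e, 0 < e ->
     exists2 d, 0 < d & forall b, width b < d -> width (G b) < e).

(* Not part of the notion of inclusion function.  Monotonicity of the output in
   the precision fails without it: refining a box may enlarge its enclosure. *)
Definition isotone_inside (R : realType) (n : nat)
    (Omega : set 'rV[R]_n) (G : box R n -> box R n) : Prop :=
  forall b c, box_set b `<=` box_set c -> box_set c `<=` Omega ->
    box_set (G b) `<=` box_set (G c).

Record cpre_state (R : realType) (n : nat) : Type := CPreState {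
  todo : seq (box R n) ;
  inner : seq (box R n) ;
  boundary : seq (box R n) ;
  outer : seq (box R n) }.

Definition cpre_start (R : realType) (n : nat) (L : seq (box R n)) :
  cpre_state R n := CPreState L [::] [::] [::].

Definition misses (R : realType) (n : nat) (M : Type)
    (F : M -> box R n -> box R n) (Y : set 'rV[R]_n) (b : box R n) : Prop :=
  forall p, box_set (F p b) `&` Y = set0.

Definition enters (R : realType) (n : nat) (M : Type)
    (F : M -> box R n -> box R n) (Y : set 'rV[R]_n) (b : box R n) : Prop :=
  exists p, box_set (F p b) `<=` Y.

(* One iteration of the loop.  The order in which boxes are removed and the
   choice among the coordinates of maximal side are left unspecified. *)
Inductive cpre_step (R : realType) (n : nat) (M : Type)
    (F : M -> box R n -> box R n) (eps : R) (Y : set 'rV[R]_n) :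
    cpre_state R n -> cpre_state R n -> Prop :=
| CPreOuter s1 b s2 X D C :
    misses F Y b ->
    cpre_step F eps Y (CPreState (s1 ++ b :: s2) X D C)
                      (CPreState (s1 ++ s2) X D (b :: C))
| CPreInner s1 b s2 X D C :
    ~ misses F Y b -> enters F Y b ->
    cpre_step F eps Y (CPreState (s1 ++ b :: s2) X D C)
                      (CPreState (s1 ++ s2) (b :: X) D C)
| CPreBoundary s1 b s2 X D C :
    ~ misses F Y b -> ~ enters F Y b -> width b < eps ->
    cpre_step F eps Y (CPreState (s1 ++ b :: s2) X D C)
                      (CPreState (s1 ++ s2) X (b :: D) C)
| CPreBisect s1 b s2 X D C (j : 'I_n) :
    ~ misses F Y b -> ~ enters F Y b -> eps <= width b ->
    side b j = width b ->
    cpre_step F eps Y (CPreState (s1 ++ b :: s2) X D C)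
      (CPreState (s1 ++ [:: lower_half b j, upper_half b j & s2]) X D C).

(* A configuration is the current target set together with the state of the
   running call to CPre. *)
Definition config (R : realType) (n : nat) : Type :=
  (set 'rV[R]_n * cpre_state R n)%type.

Inductive outer_step (R : realType) (n : nat) (M : Type)
    (F : M -> box R n -> box R n) (eps : R) :
    config R n -> config R n -> Prop :=
| OuterCPre Y s t :
    cpre_step F eps Y s t -> outer_step F eps (Y, s) (Y, t)
| OuterRepeat Y X D C :
    C <> [::] ->
    outer_step F eps (Y, CPreState [::] X D C)
      (box_union (X ++ D), cpre_start (X ++ D)).

Definition outer_output (R : realType) (n : nat) (M : Type)
    (F : M -> box R n -> box R n) (eps : R) (Omega : set 'rV[R]_n)
    (L0 : seq (box R n)) (Z : set 'rV[R]_n) : Prop :=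
  exists Y X D,
    clos_refl_trans _ (outer_step F eps)
      (Omega, cpre_start L0) (Y, CPreState [::] X D [::]) /\
    Z = box_union (X ++ D).

(* No execution is infinite, and some execution reaches the stopping test. *)
Definition outer_terminates (R : realType) (n : nat) (M : Type)
    (F : M -> box R n -> box R n) (eps : R) (Omega : set 'rV[R]_n)
    (L0 : seq (box R n)) : Prop :=
  ~ (exists c : nat -> config R n, c 0%N = (Omega, cpre_start L0) /\
       forall k, outer_step F eps (c k) (c k.+1)) /\
  exists Z, outer_output F eps Omega L0 Z.

(* Main.v *)
Require Import Defs.
From mathcomp Require Import all_boot all_order all_algebra.
From mathcomp Require Import all_classical all_reals all_analysis.
From mathcomp Require Import zify ring lra.

(** Every question about an execution is answered by a quantity or a property
  that each single step respects, so nothing depends on the order in which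
  boxes are removed or on the coordinates that are bisected.

  Termination ([outer_algorithm_terminates]).  Give a box the weight
  [3 ^ m], where [m] adds up the integer parts of its sides divided by [eps].
  Bisecting a side that is at least [eps] lowers [m] for both halves, and two
  boxes of at most a third of its weight are together lighter than the box.
  Thus the total weight of the boxes not yet discarded drops whenever a box is
  bisected or discarded, and the algorithm starts another call only after a
  discard.

  Survival ([cells_survive]).  Consider a family of sets, the cells, each
  contained in one initial box.  If bisection never cuts a cell, and a box that
  contains a cell is never seen to miss a target that contains all the cells,
  then all the cells remain covered to the end.  Two instances matter.
  - The cells are the points of a controlled invariant set: from such a point
    some mode stays in the set, hence in the target.  So the output contains
    every controlled invariant subset of [Omega].
  - The cells come from the output for a smaller precision [eps1]: the points
    of its inner boxes and its boundary boxes as a whole.  Boundary boxes are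
    uncut because all boxes are dyadic subdivisions of the initial ones: the
    midpoint of a dyadic interval is never inside a shorter dyadic interval
    ([dyadic_uncut]), and a run of precision [eps2] bisects only sides of
    length at least [eps2 > eps1].  Isotonicity says that a box is not seen to
    miss a target that a smaller box is seen to meet.  So the outputs are
    nested.

  Convergence.  At the end a retained box either maps into the output [Y], or
  has width below [eps] and an enclosure that meets [Y]; in both cases each of
  its points is mapped within [rho1 * eps] of [Y] by some mode
  ([output_sub_pre]).  Let [eps] tend to 0: by continuity and the finiteness of
  the set of modes, the upper limit of the outputs, that is the set of limits
  of points taken from outputs of arbitrarily small precision, is controlled
  invariant ([upper_limit_invariant]).  It lies in [Omega], which is closed,
  and contains the intersection of the outputs, so this intersection is
  contained in the maximal controlled invariant set.  Using the upper limit,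
  rather than the intersection itself, avoids the nesting of the outputs, which
  requires isotone inclusion functions. *)

Set Implicit Arguments.
Unset Strict Implicit.
Unset Printing Implicit Defensive.

Import Order.TTheory GRing.Theory Num.Theory.
Import numFieldNormedType.Exports.

Local Open Scope classical_set_scope.
Local Open Scope ring_scope.

(** * Boxes and bisection *)

Section Boxes.
Context {R : realType} {n : nat}.
Implicit Types (b c r : box R n) (j : 'I_n) (x y : 'rV[R]_n).

Lemma lo_le_hi b i : lo b 0 i <= hi b 0 i.
Proof. by have /forallP := valP b; apply. Qed.

Lemma side_le_width b i : side b i <= width b.
Proof. exact: le_bigmax. Qed.

Lemma width_attained b : 0 < width b -> exists j, side b j = width b.
Proof.
move=> w0; case: (pselect (exists j : 'I_n, True)) => [[j _]|nj].
  have [i|i _ wi] := @eq_bigmax _ _ _ 0 j xpredT (side b) isT; last by exists i.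
  by rewrite /side subr_ge0 lo_le_hi.
by move: w0; rewrite /width big_pred0 ?ltxx// => i;
  case: nj; exists i.
Qed.

Lemma dist_le_width b x y : box_set b x -> box_set b y -> `|x - y| <= width b.
Proof.
have w0 : 0 <= width b by exact: bigmax_ge_id.
move=> bx by_; rewrite /Num.norm/= mx_normrE; apply: bigmax_le => // -[k i] _ /=.
rewrite ord1 !mxE; apply: le_trans (side_le_width b i).
move: (bx i) (by_ i) => /andP[? ?] /andP[? ?].
by rewrite /side ler_norml; apply/andP; split; lra.
Qed.

Lemma box_set_lower b j :
  box_set (lower_half b j) = box_set b `&` [set x | x 0 j <= mid b j].
Proof.
have := lo_le_hi b j; rewrite /mid => le_b; apply/seteqP; split => x /=.
  move=> bx; split => [i|]; last first.
    by have := bx j; rewrite /lower_half /lo /hi /= mxE eqxx => /andP[].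
  have := bx i; rewrite /lower_half {1}/lo {1}/hi /= mxE -/(lo b) -/(hi b).
  by case: eqP => [->|//]; rewrite /mid => /andP[-> /=]; lra.
move=> [bx xj] i; rewrite /lower_half {1}/lo {1}/hi /= mxE -/(lo b).
by have /andP[-> ?] := bx i; case: eqP => [->|//].
Qed.

Lemma box_set_upper b j :
  box_set (upper_half b j) = box_set b `&` [set x | mid b j <= x 0 j].
Proof.
have := lo_le_hi b j; rewrite /mid => le_b; apply/seteqP; split => x /=.
  move=> bx; split => [i|]; last first.
    by have := bx j; rewrite /upper_half /lo /hi /= mxE eqxx => /andP[].
  have := bx i; rewrite /upper_half {1}/lo {1}/hi /= mxE -/(lo b) -/(hi b).
  by case: eqP => [->|//]; rewrite /mid => /andP[? ->]; rewrite andbT; lra.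
move=> [bx xj] i; rewrite /upper_half {1}/lo {1}/hi /= mxE -/(hi b).
by have /andP[? ->] := bx i; rewrite andbT; case: eqP => [->|//].
Qed.

Lemma box_set_halves b j :
  box_set b = box_set (lower_half b j) `|` box_set (upper_half b j).
Proof.
rewrite box_set_lower box_set_upper -setIUr; apply/esym/setIidPl => x _ /=.
by have [?|/ltW ?] := leP (x 0 j) (mid b j); [left|right].
Qed.

Lemma side_lower b j i :
  side (lower_half b j) i = if i == j then side b j / 2 else side b i.
Proof.
rewrite /side /lower_half {1}/lo {1}/hi /= mxE -/(lo b) -/(hi b).
by case: eqP => [->|//]; rewrite /mid; field.
Qed.

Lemma side_upper b j i :
  side (upper_half b j) i = if i == j then side b j / 2 else side b i.
Proof.
rewrite /side /upper_half {1}/lo {1}/hi /= mxE -/(lo b) -/(hi b).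
by case: eqP => [->|//]; rewrite /mid; field.
Qed.

(** Each side of [b] is an interval of the regular grid that cuts the same side
  of [r] into [2 ^ k] equal parts; the level [k] may differ from
  one coordinate to another, as a bisection refines a single one. *)
Definition dyadic r b := forall i, exists k m : nat,
  lo b 0 i = lo r 0 i + m%:R * (side r i / 2 ^+ k) /\
  side b i = side r i / 2 ^+ k.

Lemma dyadic_refl r : dyadic r r.
Proof. by move=> i; exists 0%N, 0%N; split; rewrite ?expr0; field. Qed.

Lemma dyadic_lower r b j : dyadic r b -> dyadic r (lower_half b j).
Proof.
move=> rb i; have [k [m [lob sb]]] := rb i; rewrite side_lower.
case: (eqVneq i j) => [ij|_]; last by exists k, m.
have k0 : 2 ^+ k != 0 :> R by rewrite expf_neq0.
exists k.+1, (2 * m)%N; rewrite -ij sb /lower_half {1}/lo /= lob exprS natrM.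
by split; field.
Qed.

Lemma dyadic_upper r b j : dyadic r b -> dyadic r (upper_half b j).
Proof.
move=> rb i; have [k [m [lob sb]]] := rb i; rewrite side_upper.
rewrite {1}/upper_half {1}/lo /= mxE -/(lo b).
case: (eqVneq i j) => [ij|_]; last by exists k, m.
have k0 : 2 ^+ k != 0 :> R by rewrite expf_neq0.
exists k.+1, (2 * m + 1)%N; rewrite -ij sb exprS natrD natrM.
have -> : mid b i = lo b 0 i + side b i / 2 by rewrite /mid /side; field.
by rewrite lob sb; split; field.
Qed.

(** In units of the shorter side, both ends of [c] are consecutive integers and
  the midpoint of the longer side of [b] is an integer, so it cannot fall
  strictly between them. *)
Lemma dyadic_uncut r b c j : dyadic r b -> dyadic r c -> side c j < side b j ->
  hi c 0 j <= mid b j \/ mid b j <= lo c 0 j.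
Proof.
move=> rb rc; have [l [q [lob sb]]] := rb j; have [k [m [loc sc]]] := rc j.
have hic : hi c 0 j = lo c 0 j + side c j by rewrite /side; ring.
have -> : mid b j = lo b 0 j + side b j / 2 by rewrite /mid /side; field.
have : 0 <= side r j by rewrite subr_ge0 lo_le_hi.
rewrite hic lob loc sb sc le_eqVlt => /orP[/eqP<-|s0].
  by rewrite !mul0r ltxx.
have p0 i : 0 < 2 ^+ i :> R by rewrite exprn_gt0.
rewrite ltr_pM2l// ltf_pV2 ?posrE//.
rewrite ltr_eXn2l ?ltr1n// => lk.
have [d ->] : exists d, k = (l + d.+1)%N by exists (k - l).-1; lia.
set u := side r j / 2 ^+ (l + d.+1).
have u0 : 0 <= u by rewrite divr_ge0// ltW.
have hl : side r j / 2 ^+ l = 2 * 2 ^+ d * u.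
  by rewrite /u exprD exprS; field; rewrite !gt_eqF.
rewrite hl.
have -> : lo r 0 j + q%:R * (2 * 2 ^+ d * u) + 2 * 2 ^+ d * u / 2 =
    lo r 0 j + ((q * 2 + 1) * 2 ^ d)%N%:R * u.
  by rewrite natrM natrD natrM natrX; field.
have -> : lo r 0 j + m%:R * u + u = lo r 0 j + m.+1%:R * u.
  by rewrite -natr1; ring.
have [h|h] := ltnP m ((q * 2 + 1) * 2 ^ d); [left|right].
  by rewrite lerD2l ler_wpM2r// ler_nat.
by rewrite lerD2l ler_wpM2r// ler_nat.
Qed.

Lemma dyadic_sub_half r b c j : dyadic r b -> dyadic r c -> side c j < side b j ->
  box_set c `<=` box_set b ->
  box_set c `<=` box_set (lower_half b j) \/
  box_set c `<=` box_set (upper_half b j).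
Proof.
move=> rb rc scb cb; rewrite box_set_lower box_set_upper.
have [h|h] := dyadic_uncut rb rc scb; [left|right] => x cx; split; try exact: cb.
  by apply: le_trans h; have /andP[] := cx j.
by apply: (le_trans h); have /andP[] := cx j.
Qed.

End Boxes.

(** * Termination *)

Section Termination.
Context {R : realType} {n : nat} {M : Type}.
Variables (F : M -> box R n -> box R n) (eps : R).
Hypothesis eps_gt0 : 0 < eps.
Implicit Types (b : box R n) (s t : cpre_state R n) (c : config R n).

(** The base 3 makes the two halves of a box, each of weight at most a third of
  the weight of the box, strictly lighter together. *)
Definition weight b : nat := 3 ^ \sum_(i < n) Num.truncn (side b i / eps).

Lemma weight_gt0 b : (0 < weight b)%N.
Proof. by rewrite expn_gt0. Qed.

Lemma truncn_half_lt (x : R) : 1 <= x -> (Num.truncn (x / 2) < Num.truncn x)%N.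
Proof.
move=> x1; have x0 : 0 <= x by lra.
rewrite truncn_lt_nat ?divr_ge0//.
have := truncnS_gt x; have : 1 <= (Num.truncn x)%:R :> R.
  by rewrite ler1n truncn_gt0.
by rewrite -natr1; lra.
Qed.

Lemma weight_halved b b' j : eps <= side b j ->
  (forall i, side b' i = if i == j then side b j / 2 else side b i) ->
  (3 * weight b' <= weight b)%N.
Proof.
move=> ej sb'; rewrite -expnS leq_exp2l// (bigD1 j)//= [leqRHS](bigD1 j)//=.
rewrite sb' eqxx mulrAC -addSn leq_add//.
  by apply: truncn_half_lt; rewrite ler_pdivlMr// mul1r.
by rewrite (eq_bigr (fun i => Num.truncn (side b i / eps)))// => i /negbTE ij;
  rewrite sb' ij.
Qed.

Lemma weight_bisect b j : eps <= side b j ->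
  (weight (lower_half b j) + weight (upper_half b j) < weight b)%N.
Proof.
move=> ej; have := weight_halved ej (side_lower b j).
have := weight_halved ej (side_upper b j).
have := weight_gt0 b; lia.
Qed.

Definition retained s := todo s ++ inner s ++ boundary s.

Definition total_weight s : nat := \sum_(b <- retained s) weight b.

(** Discarding a box removes at least 2 and may add 1 by making [outer] nonempty;
  that 1 pays for the next call, which empties [outer]. *)
Definition remaining_work s : nat :=
  (2 * total_weight s + (outer s != [::]))%N.

(** A single number for the lexicographic order on the remaining work and the
  length of [todo].  The length never exceeds the work, as weights are
  positive, so it is outweighed by a change of the square of the work. *)
Definition config_measure (c : config R n) : nat :=
  (remaining_work c.2 ^ 2 + size (todo c.2))%N.

Lemma size_le_weight (L : seq (box R n)) : (size L <= \sum_(b <- L) weight b)%N.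
Proof.
elim: L => [|b L IH]; first by rewrite big_nil.
by rewrite big_cons /=; have := weight_gt0 b; lia.
Qed.

Lemma size_todo_le s : (size (todo s) <= remaining_work s)%N.
Proof.
have := size_le_weight (todo s).
by rewrite /remaining_work /total_weight /retained big_cat/=; lia.
Qed.

Lemma measure_lt c d : (remaining_work d.2 < remaining_work c.2)%N ->
  (config_measure d < config_measure c)%N.
Proof.
move=> h; have := size_todo_le d.2; have := leq_mul h h.
rewrite /config_measure -!mulnn.
move: (remaining_work d.2) (remaining_work c.2) (size (todo d.2)) h => p q k _.
by rewrite mulnS mulSn; lia.
Qed.

Lemma measure_lt_todo c d : (remaining_work d.2 <= remaining_work c.2)%N ->
  (size (todo d.2) < size (todo c.2))%N ->
  (config_measure d < config_measure c)%N.
Proof. by rewrite -leq_sqr /config_measure; lia. Qed.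

Lemma outer_step_measure c d : outer_step F eps c d ->
  (config_measure d < config_measure c)%N.
Proof.
case=> [Y s t st|Y X D C C0]; last first.
  apply: measure_lt.
  rewrite /remaining_work /total_weight /retained /= !cats0.
  by move: C0; case: C => //= *; lia.
case: st => [s1 b s2 X D C _|s1 b s2 X D C _ _|s1 b s2 X D C _ _ _|
    s1 b s2 X D C j _ _ eb sb].
- apply: measure_lt; rewrite /remaining_work /total_weight /retained /= !big_cat.
  by rewrite big_cons /=; have := weight_gt0 b; case: (C) => /= *; lia.
- apply: measure_lt_todo => /=; last by rewrite !size_cat /=; lia.
  by rewrite /remaining_work /total_weight /retained /= !(big_cat, big_cons);
    move=> /=; lia.
- apply: measure_lt_todo => /=; last by rewrite !size_cat /=; lia.
  by rewrite /remaining_work /total_weight /retained /= !(big_cat, big_cons);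
    move=> /=; lia.
- apply: measure_lt; rewrite /remaining_work /total_weight /retained /= !big_cat.
  by rewrite !big_cons /=; have := @weight_bisect b j; rewrite sb => /(_ eb); lia.
Qed.

Lemma outer_step_progress Y s : todo s <> [::] \/ outer s <> [::] ->
  exists d, outer_step F eps (Y, s) d.
Proof.
case: s => [[|b T] X D C] /= h.
  by exists (box_union (X ++ D), cpre_start (X ++ D)); constructor; case: h.
have [mb|mb] := pselect (misses F Y b).
  by exists (Y, CPreState T X D (b :: C)); constructor; exact: (CPreOuter _ [::]).
have [eb|eb] := pselect (enters F Y b).
  by exists (Y, CPreState T (b :: X) D C); constructor; exact: (CPreInner _ [::]).
have [wb|wb] := ltP (width b) eps.
  exists (Y, CPreState T X (b :: D) C); constructor.
  exact: (CPreBoundary [::]).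
have [j sj] := width_attained (lt_le_trans eps_gt0 wb).
exists (Y, CPreState [:: lower_half b j, upper_half b j & T] X D C).
by constructor; exact: (CPreBisect [::]).
Qed.

Lemma outer_algorithm_terminates Omega L0 : outer_terminates F eps Omega L0.
Proof.
split.
  move=> [c [_ cS]].
  have dec k : (config_measure (c k) + k <= config_measure (c 0%N))%N.
    elim: k => [|k IH]; first by rewrite addn0.
    by have := outer_step_measure (cS k); lia.
  by have := dec (config_measure (c 0%N)).+1; lia.
suff run c : exists Y X D,
    clos_refl_trans _ (outer_step F eps) c (Y, CPreState [::] X D [::]).
  have [Y [X [D r]]] := run (Omega, cpre_start L0).
  by exists (box_union (X ++ D)), Y, X, D.
have [m] := ubnP (config_measure c); elim: m c => // m IH [Y s] ms.
have [[sT sC]|/not_andP h] := pselect (todo s = [::] /\ outer s = [::]).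
  exists Y, (inner s), (boundary s).
  by case: s sT sC {ms} => ???? /= -> ->; exact: rt_refl.
have [d sd] := outer_step_progress Y h.
have [|Y' [X [D r]]] := IH d; first by have := outer_step_measure sd; lia.
by exists Y', X, D; apply: rt_trans r; exact: rt_step.
Qed.

End Termination.

(** * What every execution preserves *)

Section Runs.
Context {R : realType} {n : nat} {M : Type}.
Variables (F : M -> box R n -> box R n) (eps : R).
Variables (Omega : set 'rV[R]_n) (L0 : seq (box R n)).
Hypothesis OmegaE : Omega = box_union L0.
Implicit Types (b r : box R n) (c d : config R n) (L : seq (box R n)).

Lemma eq_box_union L L' : L =i L' -> box_union L = box_union L'.
Proof.
by move=> LL'; apply/seteqP; split => x [b bL bx]; exists b => //=;
  rewrite ?LL'// -LL'.
Qed.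

Lemma box_union_cons b L : box_union (b :: L) = box_set b `|` box_union L.
Proof.
apply/seteqP; split => x.
  move=> [d /=]; rewrite inE => /orP[/eqP->|dL] dx; first by left.
  by right; exists d.
move=> [bx|[d dL dx]]; first by exists b => //=; rewrite inE eqxx.
by exists d => //=; rewrite inE (dL : d \in L) orbT.
Qed.

Lemma sub_box_union b L : b \in L -> box_set b `<=` box_union L.
Proof. by move=> bL x bx; exists b. Qed.

Lemma box_union_cat L L' : box_union (L ++ L') = box_union L `|` box_union L'.
Proof.
elim: L => [|b L IH] /=; last by rewrite !box_union_cons IH setUA.
by rewrite /box_union [X in _ = X `|` _]bigcup0 ?set0U.
Qed.

Lemma outer_run_ind (P : config R n -> Prop) :
  (forall c d, P c -> outer_step F eps c d -> P d) ->
  forall c d, clos_refl_trans _ (outer_step F eps) c d -> P c -> P d.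
Proof.
move=> PS c d; elim => [x y xy Px|//|x y z _ IH1 _ IH2 Px]; first exact: PS xy.
exact/IH2/IH1.
Qed.

(** A new call starts without inner and boundary boxes, so the last two
  properties may refer to the current target although it shrinks from call to
  call. *)
Definition sound c : Prop :=
  [/\ c.1 `<=` Omega,
      box_union (retained c.2 ++ outer c.2) = c.1,
      forall b, b \in retained c.2 -> exists2 r, r \in L0 &
        dyadic r b /\ box_set b `<=` box_set r,
      forall b, b \in inner c.2 -> enters F c.1 b &
      forall b, b \in boundary c.2 -> ~ misses F c.1 b /\ width b < eps].

Lemma sound_start : sound (Omega, cpre_start L0).
Proof.
split=> //=; first by rewrite /retained /= !cats0.
by move=> b; rewrite /retained /= cats0 => bL; exists b => //; split;
  first exact: dyadic_refl.
Qed.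

(* Decides equalities and implications between memberships in lists that have
   the same parts in a different order. *)
Ltac mem_cases :=
  rewrite /retained /= !(inE, mem_cat);
  by do ?case: (_ == _); do ?case: (_ \in _).

Lemma sound_step c d : sound c -> outer_step F eps c d -> sound d.
Proof.
move=> + cd; case: cd => [Y s t st|Y X D C _]; last first.
  move=> [/= YO UE dy _ _].
  have E : retained (cpre_start (X ++ D)) = X ++ D by rewrite /retained /= cats0.
  split=> //=.
  - apply: subset_trans YO; rewrite -UE /retained /= [X in _ `<=` X]box_union_cat.
    exact: subsetUl.
  - by rewrite E cats0.
  - by rewrite E.
case: st => [s1 b s2 X D C mb|s1 b s2 X D C _ eb|s1 b s2 X D C mb eb wb|
    s1 b s2 X D C j _ _ eb sb] [/= YO UE dy inn bnd]; split => //=.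
- by rewrite -[RHS]UE; apply: eq_box_union => ?; mem_cases.
- move=> b' b'L; apply: dy; move: b'L; mem_cases.
- by rewrite -[RHS]UE; apply: eq_box_union => ?; mem_cases.
- move=> b' b'L; apply: dy; move: b'L; mem_cases.
- by move=> b'; rewrite inE => /orP[/eqP->//|]; exact: inn.
- by rewrite -[RHS]UE; apply: eq_box_union => ?; mem_cases.
- move=> b' b'L; apply: dy; move: b'L; mem_cases.
- by move=> b'; rewrite inE => /orP[/eqP->//|]; exact: bnd.
- rewrite -[RHS]UE /retained /= !(box_union_cat, box_union_cons).
  by rewrite (box_set_halves b j) !setUA.
- have [|r rL [rb br]] := dy b.
    by rewrite /retained /= !(inE, mem_cat) eqxx orbT.
  move=> b'; rewrite /retained /= !(inE, mem_cat) => b'L.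
  have [/eqP->|] := boolP (b' == lower_half b j).
    exists r => //; split; first exact: dyadic_lower.
    by apply: subset_trans br; rewrite (box_set_halves b j); exact: subsetUl.
  have [/eqP-> _|/negbTE nu /negbTE nl] := boolP (b' == upper_half b j).
    exists r => //; split; first exact: dyadic_upper.
    by apply: subset_trans br; rewrite (box_set_halves b j); exact: subsetUr.
  apply: dy; move: b'L; rewrite nu nl; mem_cases.
Qed.

(** The run stops when a call has discarded nothing, so the target of that call,
  which the inner and boundary boxes refer to, is already the output. *)
Lemma outer_outputP Z : outer_output F eps Omega L0 Z -> exists X D,
  [/\ Z = box_union (X ++ D), Z `<=` Omega,
      forall b, b \in X ++ D -> exists2 r, r \in L0 &
        dyadic r b /\ box_set b `<=` box_set r,
      forall b, b \in X -> enters F Z b &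
      forall b, b \in D -> ~ misses F Z b /\ width b < eps].
Proof.
move=> [Y [X [D [run ->]]]].
have [/= YO UE dy inn bnd] := outer_run_ind sound_step run sound_start.
exists X, D; move: UE; rewrite /retained /= cats0 => UE.
by split => //; rewrite ?UE.
Qed.

(** [K r k] says that [k] is a cell of the initial box [r].  The box that covers
  [k] is required to descend from the same [r], because dyadic grids of
  different initial boxes need not be compatible.  All cells being covered,
  each target contains all of them, so by the last hypothesis no covering box
  is ever discarded. *)
Lemma cells_survive (K : box R n -> set 'rV[R]_n -> Prop) :
  (forall r k, K r k -> r \in L0 /\ k `<=` box_set r) ->
  (forall r k b j, K r k -> dyadic r b -> eps <= side b j ->
     k `<=` box_set b ->
     k `<=` box_set (lower_half b j) \/ k `<=` box_set (upper_half b j)) ->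
  (forall r k b Y, K r k -> (forall r' k', K r' k' -> k' `<=` Y) ->
     box_set b `<=` Omega -> k `<=` box_set b -> ~ misses F Y b) ->
  forall Z, outer_output F eps Omega L0 Z -> forall r k, K r k -> k `<=` Z.
Proof.
move=> K0 Kcut Kmiss Z [Y [X [D [run ->]]]].
pose held c := forall r k, K r k ->
  exists2 b, b \in retained c.2 & dyadic r b /\ k `<=` box_set b.
suff [_ hold] : sound (Y, CPreState [::] X D [::]) /\
    held (Y, CPreState [::] X D [::]).
  by move=> r k /hold[b bXD [_ kb]]; apply: (subset_trans kb);
    exact: sub_box_union.
apply: (outer_run_ind (P := fun c => sound c /\ held c) _ run); last first.
  split; first exact: sound_start.
  move=> r k /K0[rL kr]; exists r; first by rewrite /retained /= cats0.
  by split => //; exact: dyadic_refl.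
move=> c d [sc hc] cd; split; first exact: sound_step cd.
have {sc} [cO cU _ _ _] := sc.
have cover r k : K r k -> k `<=` c.1.
  move=> /hc[b bc [_ kb]]; apply: (subset_trans kb); rewrite -cU.
  by apply: sub_box_union; rewrite mem_cat bc.
have inO b : b \in retained c.2 -> box_set b `<=` Omega.
  move=> bc; apply: subset_trans cO; rewrite -cU.
  by apply: sub_box_union; rewrite mem_cat bc.
case: cd hc cover inO {cO cU} => [V s t st|V X' D' C _] hc cover inO; last first.
  move=> r k /hc[b bc bk]; exists b => //.
  by move: bc; rewrite /retained /= cats0.
move=> r k Krk; have [b' b'c [rb' kb']] := hc r k Krk.
case: st hc cover inO b'c => [s1 b s2 X' D' C mb|s1 b s2 X' D' C _ eb|
    s1 b s2 X' D' C mb eb wb|s1 b s2 X' D' C j _ _ eb sb] /= hc cover inO b'c.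
- exists b' => //; have : b' != b.
    apply/eqP => bb; rewrite bb in b'c kb'.
    by apply: (Kmiss r k b V) => //; exact: inO.
  move: b'c; mem_cases.
- exists b' => //; move: b'c; mem_cases.
- exists b' => //; move: b'c; mem_cases.
- have [bb|b'b] := eqVneq b' b; last first.
    exists b' => //; move: b'c b'b; mem_cases.
  rewrite {}bb in rb' kb'; rewrite -sb in eb.
  have [kh|kh] := Kcut r k b j Krk rb' eb kb'.
    exists (lower_half b j); last by split; first exact: dyadic_lower.
    by rewrite /retained /= !(inE, mem_cat) eqxx !orbT.
  exists (upper_half b j); last by split; first exact: dyadic_upper.
  by rewrite /retained /= !(inE, mem_cat) eqxx !orbT.
Qed.

End Runs.

(** * Consequences for the outputs *)

Section Outputs.
Context {R : realType} {n : nat} {M : Type}.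
Variables (f : M -> 'rV[R]_n -> 'rV[R]_n) (F : M -> box R n -> box R n).
Variables (Omega : set 'rV[R]_n) (L0 : seq (box R n)).
Hypothesis OmegaE : Omega = box_union L0.
Hypothesis F_incl : forall p b, f p @` box_set b `<=` box_set (F p b).

(** The cells are the points of [J].  A box containing [x] in [J] cannot miss
  the target: the mode that keeps [x] in [J] sends it into the target, and the
  enclosure of the box contains that image. *)
Lemma invariant_sub_output J eps Z : controlled_invariant f J ->
  J `<=` Omega -> outer_output F eps Omega L0 Z -> J `<=` Z.
Proof.
move=> Jinv JO out.
pose K r k := r \in L0 /\ exists x, [/\ J x, box_set r x & k = [set x]].
have KJ x : J x -> exists r, K r [set x].
  move=> Jx; have := JO x Jx; rewrite OmegaE => -[r rL rx].
  by exists r; split => //; exists x.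
have KZ := @cells_survive _ _ _ F eps Omega L0 OmegaE K _ _ _ Z out.
move=> x Jx; have [r Kr] := KJ x Jx.
apply: (KZ _ _ _ r [set x]) => //.
- by move=> {x Jx r Kr} r k [rL [x [_ rx ->]]]; split=> // y ->.
- move=> {x Jx r Kr} r k b j [rL [x [_ rx ->]]] _ _ kb.
  have := kb x erefl; rewrite (box_set_halves b j).
  by case=> h; [left|right] => y ->.
- move=> {x Jx r Kr} r k b Y [rL [x [Jx rx ->]]] KY _ kb mb.
  have [p pJ] := Jinv x Jx.
  have [r' Kr'] := KJ _ (pJ 1%N).
  have Yx : Y (f (p 0%N) x) by exact: KY Kr' _ erefl.
  have : (box_set (F (p 0%N) b) `&` Y) (f (p 0%N) x).
    by split => //; apply: F_incl; exists x => //; exact: kb.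
  by rewrite mb.
Qed.

(** A point of an inner box of the run for [eps1] is sent into [Z1] by some mode,
  so it can be followed on its own, as for an invariant set.  For a boundary
  box only its enclosure as a whole is known to meet [Z1]; it has to be followed
  undivided, which is possible because its sides are shorter than those that
  the run for [eps2] bisects. *)
Lemma output_monotone eps1 eps2 Z1 Z2 :
  (forall p, isotone_inside Omega (F p)) -> eps1 < eps2 ->
  outer_output F eps1 Omega L0 Z1 -> outer_output F eps2 Omega L0 Z2 ->
  Z1 `<=` Z2.
Proof.
move=> iso e12 /(outer_outputP OmegaE)[X [D [Z1E Z1O dy inn bnd]]] out2.
pose K r k := r \in L0 /\
  ((exists x c, [/\ c \in X, box_set c x, box_set r x & k = [set x]]) \/
   (exists c, [/\ c \in D, dyadic r c, box_set c `<=` box_set r &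
      k = box_set c])).
have KZ x : Z1 x -> exists r k, K r k /\ k x.
  rewrite {1}Z1E => -[c /= cXD cx]; have [r rL [rc cr]] := dy c cXD.
  move: cXD; rewrite mem_cat => /orP[cX|cD].
    exists r, [set x]; split => //; split => //; left; exists x, c.
    by split=> //; exact: cr.
  by exists r, (box_set c); split => //; split => //; right; exists c.
have surv := @cells_survive _ _ _ F eps2 Omega L0 OmegaE K _ _ _ Z2 out2.
move=> x /KZ[r [k [Krk kx]]].
apply: (surv _ _ _ r k) kx => //.
- move=> {x r k Krk} r k [rL [[x [c [_ _ rx ->]]]|[c [_ _ cr ->]]]]; split => //.
  by move=> y ->.
- move=> {x r k Krk} r k b j [rL [[x [c [_ _ rx ->]]]|[c [cD rc _ ->]]]] rb eb kb.
    have := kb x erefl; rewrite (box_set_halves b j).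
    by case=> h; [left|right] => y ->.
  apply: (dyadic_sub_half rb) => //.
  apply: le_lt_trans (side_le_width c j) _.
  by apply: lt_le_trans eb; apply: lt_trans e12; have [] := bnd c cD.
- move=> {x r k Krk} r k b Y Krk KY bO kb mb.
  have ZY : Z1 `<=` Y by move=> x /KZ[r' [k' [Kr' k'x]]]; exact: KY Kr' _ k'x.
  have meet p y : box_set (F p b) y -> Z1 y -> False.
    move=> Fy Zy; suff : (box_set (F p b) `&` Y) y by rewrite mb.
    by split => //; exact: ZY.
  have [_ [[x [c [cX cx _ kE]]]|[c [cD _ _ kE]]]] := Krk.
    have [p Fp] := inn c cX; apply: (meet p (f p x)).
      by apply: F_incl; exists x => //; apply: kb; rewrite kE.
    by apply: Fp; apply: F_incl; exists x.
  have [nm _] := bnd c cD; apply: nm => p; rewrite -subset0 => y [Fy Zy].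
  apply: (meet p y) => //; apply: iso Fy => //.
  by rewrite -kE.
Qed.

Lemma output_sub_pre rho eps Z : 0 < eps -> 0 < rho ->
  (forall p b, box_set b `<=` Omega -> width (F p b) <= rho * width b) ->
  outer_output F eps Omega L0 Z ->
  Z `<=` pre_in f (minkowski_sum Z (cball n (rho * eps))).
Proof.
move=> e0 rho0 Frho /(outer_outputP OmegaE)[X [D [ZE ZO dy inn bnd]]] x Zx.
have re0 : 0 <= rho * eps by rewrite mulr_ge0// ltW.
have sumZ z : Z z -> minkowski_sum Z (cball n (rho * eps)) z.
  move=> Zz; exists z => //; exists 0; last by rewrite addr0.
  by rewrite /cball /= normr0.
split; last exact: sumZ.
move: (Zx); rewrite {1}ZE => -[b /= bXD bx].
have Fb p : box_set (F p b) (f p x) by apply: F_incl; exists x.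
move: (bXD); rewrite mem_cat => /orP[/inn[p Fp]|/bnd[nm wb]].
  by exists p; apply/sumZ/Fp.
have [p [y [Fy Zy]]] : exists p y, box_set (F p b) y /\ Z y.
  apply: contrapT => h; apply: nm => p; rewrite -subset0 => y [Fy Zy].
  by apply: h; exists p, y.
exists p; exists y => //; exists (f p x - y); last by rewrite addrC subrK.
rewrite /cball /=; apply: (le_trans (dist_le_width (Fb p) Fy)).
apply: (le_trans (Frho p b _)).
  by apply: subset_trans ZO; rewrite ZE; exact: sub_box_union.
by rewrite ler_wpM2l// ltW.
Qed.

End Outputs.

(** * The limit of vanishing precision *)

Lemma finite_common_radius (R : realType) (M : finType) (P : M -> R -> Prop) :
  (forall p d e, P p d -> e <= d -> P p e) ->
  (forall p, exists2 d, 0 < d & P p d) ->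
  exists2 d, 0 < d & forall p, P p d.
Proof.
move=> Pdown H.
have /choice[d dP] : forall p, exists d, 0 < d /\ P p d.
  by move=> p; have [d d0 Pd] := H p; exists d.
exists (\big[Num.min/1]_p d p).
  by apply: lt_bigmin => // p _; case: (dP p).
by move=> p; apply: (Pdown _ _ _ (dP p).2); exact: bigmin_le.
Qed.

Section Limit.
Context {R : realType} {n : nat} {M : finType}.
Variables (f : M -> 'rV[R]_n -> 'rV[R]_n) (Y : R -> set 'rV[R]_n).

(** The upper limit, in the sense of Kuratowski, of [Y e] as [e] tends to 0 from
  above. *)
Definition upper_limit : set 'rV[R]_n :=
  [set x | forall d, 0 < d ->
     exists e y, [/\ 0 < e, e < d, Y e y & `|x - y| < d]].

Lemma controlled_invariant_of_step (A : set 'rV[R]_n) :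
  (0 < #|M|)%N ->
  (forall x, A x -> exists p, A (f p x)) -> controlled_invariant f A.
Proof.
move=> /card_gt0P[p0 _] step x0 Ax0.
have /choice[g gA] : forall x, exists p, A x -> A (f p x).
  move=> x; have [/step[p Ap]|nA] := pselect (A x); first by exists p.
  by exists p0.
(* The mode depends on the current state, so the trajectory is built before
   the switching signal. *)
pose s := fix s k := if k is k'.+1 then f (g (s k')) (s k') else x0.
exists (g \o s) => k.
have -> : solution f (g \o s) x0 k = s k by elim: k => //= k ->.
by elim: k => //= k; exact: gA.
Qed.

Lemma upper_limit_sub (Omega : set 'rV[R]_n) : closed Omega ->
  (forall e, 0 < e -> Y e `<=` Omega) -> upper_limit `<=` Omega.
Proof.
move=> cO YO x lx; rewrite (closure_id Omega).1//.
move=> B /nbhs_ballP[d /= d0 dB].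
have [e [y [e0 _ Ye xy]]] := lx d d0.
exists y; split; first exact: YO Ye.
by apply: dB; rewrite -ball_normE.
Qed.

(** If every mode led [x] out of the upper limit, the images [f p x] would keep a
  common distance [d] from all outputs of precision below [d].  But a point [y]
  of an output close to [x] has an image close to that output, and [f p x] is
  close to [f p y]. *)
Lemma upper_limit_invariant (rho : R) : (0 < #|M|)%N -> 0 < rho ->
  (forall p, continuous (f p)) ->
  (forall e, 0 < e ->
     Y e `<=` pre f (minkowski_sum (Y e) (cball n (rho * e)))) ->
  controlled_invariant f upper_limit.
Proof.
move=> M0 rho0 fcont Ypre; apply: controlled_invariant_of_step => // x lx.
apply: contrapT => /forallNP nl.
have [d d0 far] : exists2 d, 0 < d & forall p e y, 0 < e -> e < d -> Y e y ->
    d <= `|f p x - y|.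
  apply: (finite_common_radius (P := fun p d => forall e y, 0 < e -> e < d ->
      Y e y -> d <= `|f p x - y|)) => [p d e h ed e' y e'0 e'e Ye|p].
    exact: le_trans ed (h _ _ e'0 (lt_le_trans e'e ed) Ye).
  have [d /not_implyP[d0 h]] := (existsNP _).2 (nl p).
  exists d => // e y e0 ed Ye; rewrite leNgt; apply/negP => xy.
  by apply: h; exists e, y.
have [eta eta0 near_f] : exists2 d', 0 < d' & forall p y, `|x - y| < d' ->
    `|f p x - f p y| < d / 2.
  apply: (finite_common_radius (P := fun p d' => forall y, `|x - y| < d' ->
    `|f p x - f p y| < d / 2)) => [p d1 d2 h d21 y xy|p].
    by apply: h; exact: lt_le_trans d21.
  have d20 : 0 < d / 2 by lra.
  have /cvgrPdist_lt/(_ _ d20)/nbhs_ballP[d' /= d'0 h] := fcont p x.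
  by exists d' => // y xy; apply: h; rewrite -ball_normE.
(* The distance [d] is shared equally between the continuity of [f p] and the
   error [rho * e]. *)
have q0 : 0 < d / 2 / rho by rewrite !divr_gt0.
pose del := Num.min d (Num.min eta (d / 2 / rho)).
have del0 : 0 < del by rewrite !lt_min d0 eta0 q0.
have [e [y [e0]]] := lx del del0.
rewrite !lt_min => /and3P[ed _ eq] Ye /and3P[_ xy _].
have [p [z Yz [b bb zb]]] := Ypre e e0 y Ye.
have := far p e z e0 ed Yz; apply/negP; rewrite -ltNge.
have -> : f p x - z = (f p x - f p y) + b by rewrite -zb opprD addrA subrK.
apply: le_lt_trans (ler_normD _ _) _.
have : `|b| < d / 2.
  by apply: le_lt_trans bb _; rewrite mulrC -ltr_pdivlMr.
by have := near_f p y xy; lra.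
Qed.

End Limit.

Theorem theorem2 (R : realType) (n : nat) (M : finType)
    (f : M -> 'rV[R]_n -> 'rV[R]_n) (F : M -> box R n -> box R n)
    (Omega : set 'rV[R]_n) (L0 : seq (box R n)) (rho1 : R)
    (Iinf : set 'rV[R]_n) :
  (0 < #|M|)%N ->
  (forall p, continuous (f p)) ->
  compact Omega ->
  Omega = box_union L0 ->
  pairwise_disjoint_interiors L0 ->
  0 < rho1 ->
  (forall p x y, Omega x -> Omega y ->
     `|f p x - f p y| <= rho1 * `|x - y|) ->
  (forall p, convergent_inclusion (f p) (F p)) ->
  (forall p b, box_set b `<=` Omega -> width (F p b) <= rho1 * width b) ->
  is_max_controlled_invariant f Omega Iinf ->
  (forall eps, 0 < eps -> outer_terminates F eps Omega L0) /\
  forall Y : R -> set 'rV[R]_n,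
    (forall eps, 0 < eps -> outer_output F eps Omega L0 (Y eps)) ->
    [/\ forall eps, 0 < eps -> exists L : seq (box R n), Y eps = box_union L,
        forall eps, 0 < eps ->
          pre_in f (Y eps) `<=` Y eps /\
          Y eps `<=` pre_in f (minkowski_sum (Y eps) (cball n (rho1 * eps))),
        forall eps1 eps2, 0 < eps1 -> eps1 < eps2 ->
          Iinf `<=` Y eps1 /\
          ((forall p, isotone_inside Omega (F p)) -> Y eps1 `<=` Y eps2)
      & Iinf = \bigcap_(eps in [set e : R | 0 < e]) Y eps].
Proof.
move=> M0 fcont cO OE _ rho0 _ Fconv Frho [Jinv JO Jmax].
have Fincl p b : f p @` box_set b `<=` box_set (F p b) by have [+ _] := Fconv p.
split=> [eps eps0|Y outY]; first exact: outer_algorithm_terminates.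
have Ypre eps (e0 : 0 < eps) :=
  output_sub_pre OE Fincl e0 rho0 Frho (outY eps e0).
have JY eps : 0 < eps -> Iinf `<=` Y eps.
  by move=> /outY; exact: invariant_sub_output.
split=> [eps /outY[_ [X [D [_ ->]]]]|eps e0|e1 e2 e10 e12|].
- by exists (X ++ D).
- by split; [exact: subIsetr | exact: Ypre].
- split=> [|iso]; first exact: JY.
  have e20 := lt_trans e10 e12.
  exact: (output_monotone OE Fincl iso e12 (outY _ e10) (outY _ e20)).
apply/seteqP; split => [x Jx eps e0|x capx]; first exact: JY.
apply: (Jmax (upper_limit Y)).
- apply: (upper_limit_invariant M0 rho0 fcont) => e e0 y /(Ypre e e0).
  by case.
- apply: upper_limit_sub.
    by apply: compact_closed cO; exact: norm_hausdorff.
  by move=> e /outY/(outer_outputP OE)[? [? []]].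
- move=> d d0; have d20 : 0 < d / 2 by lra.
  exists (d / 2), x; rewrite subrr normr0; split => //; first by lra.
  exact: capx.
Qed.
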